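(* Let $\mathbb K$ be a field with $2,3\in\mathbb K^\times$ and let $\mathfrak g$ be a $3$-graded Lie algebra over $\mathbb K$ with grading element $E$ such that $\mathfrak g_0=\mathbb KE+[\mathfrak g_+,\mathfrak g_-]$. Let $q:\hat{\mathfrak g}\to\mathfrak g$ be a central extension of $\mathfrak g$, i.e. $q$ is a surjective Lie algebra homomorphism and $\ker q$ is a central subspace of $\hat{\mathfrak g}$. Let $\hat E\in\hat{\mathfrak g}$ be an element with $q(\hat E)=E$. Then $\mathrm{ad}\,\hat E$ is diagonalizable with the eigenvalues $\{\pm1,0\}$ and defines a $3$-grading $\hat{\mathfrak g}=\hat{\mathfrak g}_+\oplus\hat{\mathfrak g}_0\oplus\hat{\mathfrak g}_-$ such that $q$ is a morphism of $3$-graded Lie algebras.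
   Context: A $3$-graded Lie algebra with grading element $E\in\mathfrak g$ is a Lie algebra with $\mathrm{ad}(E)^3=\mathrm{ad}(E)$, decomposed as $\mathfrak g=\mathfrak g_+\oplus\mathfrak g_0\oplus\mathfrak g_-$ where $\mathfrak g_+,\mathfrak g_0,\mathfrak g_-$ are the eigenspaces of $\mathrm{ad}(E)$ for the eigenvalues $1,0,-1$ (eigenspaces may be zero). A morphism of $3$-graded Lie algebras is a Lie algebra homomorphism mapping each homogeneous component into the corresponding one. *)

(* Defs.v *)
From HB Require Import structures.
From mathcomp Require Import all_boot all_order all_algebra.
Set Implicit Arguments.
Unset Strict Implicit.
Unset Printing Implicit Defensive.
Import GRing.Theory.
Local Open Scope ring_scope.

(* Lie algebras over a field, of arbitrary (possibly infinite) dimension. *)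
HB.mixin Record Lmodule_isLie (K : fieldType) (L : Type)
    of GRing.Lmodule K L := {
  lie_bracket : L -> L -> L;
  lie_bracket_linearl : forall (a : K) (x y z : L),
    lie_bracket (a *: x + y) z = a *: lie_bracket x z + lie_bracket y z;
  lie_bracket_linearr : forall (a : K) (x y z : L),
    lie_bracket x (a *: y + z) = a *: lie_bracket x y + lie_bracket x z;
  lie_bracket_alt : forall x : L, lie_bracket x x = 0;
  lie_bracket_jacobi : forall x y z : L,
    lie_bracket x (lie_bracket y z) + lie_bracket y (lie_bracket z x)
      + lie_bracket z (lie_bracket x y) = 0
}.

#[short(type="lieAlgType")]
HB.structure Definition LieAlgebra (K : fieldType) :=
  { L of GRing.Lmodule K L & Lmodule_isLie K L }.

Notation "[ 'lie' x , y ]" := (lie_bracket x y)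
  (at level 0, x, y at level 99, format "[ 'lie'  x ,  y ]") : ring_scope.

Definition ad (K : fieldType) (g : lieAlgType K) (x : g) : g -> g :=
  fun y => [ lie x, y].

(* V is the internal direct sum of the subspaces A i, for i : I. *)
Definition is_direct_sum (K : fieldType) (V : lmodType K) (I : eqType)
    (A : I -> V -> Prop) : Prop :=
  (forall x : V, exists (s : seq I) (v : I -> V),
      [/\ uniq s, forall i, i \in s -> A i (v i) & x = \sum_(i <- s) v i])
  /\ (forall (s : seq I) (v : I -> V), uniq s ->
      (forall i, i \in s -> A i (v i)) -> \sum_(i <- s) v i = 0 ->
      forall i, i \in s -> v i = 0).

Definition in_eigenspace (K : fieldType) (V : lmodType K) (f : V -> V)
  (a : K) (v : V) : Prop := f v = a *: v.

Definition is_eigenvalue (K : fieldType) (V : lmodType K) (f : V -> V)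
  (a : K) : Prop := exists2 v : V, v != 0 & in_eigenspace f a v.

Definition is_diagonalizable (K : fieldType) (V : lmodType K) (f : V -> V)
  : Prop := is_direct_sum (in_eigenspace f).

(* The components g_+, g_0, g_- are those of index 1, 0, -1; the component
   of any other index is zero, so that a sum over all of int is the sum of
   these three. *)
Definition component (K : fieldType) (g : lieAlgType K) (E : g) (i : int)
    (x : g) : Prop :=
  if i \in [:: 1; 0; -1] then in_eigenspace (ad E) i%:~R x else x = 0.

Definition three_graded (K : fieldType) (g : lieAlgType K) (E : g) : Prop :=
  (forall x : g, ad E (ad E (ad E x)) = ad E x)
  /\ is_direct_sum (component E).

(* Not part of three_graded: it follows from it when 2 and 3 are invertible. *)
Definition bracket_graded (K : fieldType) (g : lieAlgType K) (E : g) : Prop :=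
  forall (i j : int) (x y : g), component E i x -> component E j y ->
    component E (i + j) [ lie x, y].

Definition bracket_span (K : fieldType) (g : lieAlgType K)
    (A B : g -> Prop) (x : g) : Prop :=
  exists (n : nat) (c : 'I_n -> K) (u v : 'I_n -> g),
    [/\ forall k, A (u k), forall k, B (v k)
      & x = \sum_(k < n) c k *: [ lie u k, v k]].

Definition lie_hom (K : fieldType) (g h : lieAlgType K) (f : {linear g -> h})
  : Prop := forall x y : g, f [ lie x, y] = [ lie f x, f y].

Definition central_extension (K : fieldType) (ghat g : lieAlgType K)
    (q : {linear ghat -> g}) : Prop :=
  [/\ lie_hom q, forall y : g, exists x : ghat, q x = y
    & forall z : ghat, q z = 0 -> forall x : ghat, [ lie z, x] = 0].

Definition three_graded_morphism (K : fieldType) (g h : lieAlgType K)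
    (E : g) (F : h) (f : {linear g -> h}) : Prop :=
  lie_hom f
  /\ forall (i : int) (x : g), component E i x -> component F i (f x).

(* Main.v *)
Require Import Defs.
From HB Require Import structures.
From mathcomp Require Import all_boot all_order all_algebra.
Set Implicit Arguments.
Unset Strict Implicit.
Unset Printing Implicit Defensive.
Import GRing.Theory.
Local Open Scope ring_scope.

(** Write D for [ad Ehat].  It lifts [ad E] along q and kills the central
    subspace [ker q], so D (D^3 - D) = 0: only the factor X of X^2 (X^2 - 1)
    may occur with multiplicity two, and what has to be excluded is a nilpotent
    part of D on [ker D^2].

    Every eigenvector of [ad E] for an eigenvalue a with a^2 = 1 lifts to an
    eigenvector of D: if w is any lift, then (D^2 + a D^3) w / 2 is one
    ([eigenvector_lift]).  As D is a derivation, the bracket of a lift for 1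
    with a lift for -1 is killed by D.  Now q maps [ker D^2] into
    g_0 = K E + [g_+, g_-]; hence an element of [ker D^2] is a combination of
    Ehat and of such brackets, up to a central element, and D kills all of
    these ([ad_lift_ker_sqr]).  Since x - D^2 x lies in [ker D^2], it follows
    that D^3 = D ([ad_lift_tripotent]).

    The rest is linear algebra of an f with f^3 = f: the three projections
    (f^2 + f) / 2, 1 - f^2 and (f^2 - f) / 2 give the eigenspace decomposition
    ([tripotent_direct_sum]).  The bracket respects it because 2 and -2 are not
    eigenvalues: a^3 - a is 6 or -6 there, which is invertible. *)

(** * Tripotent linear maps *)

(** Applying f - lam i removes the i-th term and rescales the others by
    nonzero scalars, whence an induction on s. *)
Lemma eigenvectors_free (K : fieldType) (V : lmodType K) (f : {linear V -> V})
    (I : eqType) (lam : I -> K) (s : seq I) (v : I -> V) :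
  uniq s -> {in s &, injective lam} ->
  (forall i, i \in s -> f (v i) = lam i *: v i) ->
  \sum_(i <- s) v i = 0 -> forall i, i \in s -> v i = 0.
Proof.
elim: s v => [|i s IHs] v //= /andP[i_notin_s uniq_s] lam_inj fv sum0.
have s_sub j : j \in s -> j \in i :: s by move=> js; rewrite inE js orbT.
have vs0 j : j \in s -> v j = 0.
  move=> js.
  have /eqP : (lam j - lam i) *: v j = 0.
    apply: (IHs (fun j => (lam j - lam i) *: v j)) => // [j1 j2 s1 s2|k ks|].
    - by apply: lam_inj; apply: s_sub.
    - by rewrite linearZ /= fv ?s_sub // !scalerA mulrC.
    have : f (\sum_(k <- i :: s) v k) - lam i *: (\sum_(k <- i :: s) v k) = 0.
      by rewrite sum0 linear0 scaler0 subr0.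
    rewrite linear_sum scaler_sumr -sumrB big_cons fv ?mem_head // subrr add0r.
    apply: etrans; apply: eq_big_seq => k ks.
    by rewrite fv ?s_sub // scalerBl.
  rewrite scaler_eq0 subr_eq0 => /orP[/eqP lam_ji|/eqP //].
  by rewrite -(lam_inj _ _ (s_sub _ js) (mem_head _ _) lam_ji) js in i_notin_s.
move=> j; rewrite inE => /orP[/eqP->|/vs0 //].
by rewrite big_cons (eq_big_seq (fun=> 0)) // big1 // addr0 in sum0.
Qed.

Lemma tripotent_eigenvector (K : fieldType) (V : lmodType K)
    (f : {linear V -> V}) (f3 : forall x, f (f (f x)) = f x) (a : K) (v : V) :
  f v = a *: v -> (a ^+ 3 - a) *: v = 0.
Proof.
move=> fv; have := f3 v; rewrite !(fv, linearZ) /= !scalerA => /eqP.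
by rewrite -subr_eq0 -scalerBl -expr2 -exprSr => /eqP.
Qed.

Lemma tripotent_eigenvalue (K : fieldType) (V : lmodType K)
    (f : {linear V -> V}) (f3 : forall x, f (f (f x)) = f x) (a : K) :
  is_eigenvalue f a -> a \in [:: 1; 0; -1].
Proof.
case=> v vn0 /(tripotent_eigenvector f3) /eqP.
rewrite scaler_eq0 (negPf vn0) orbF.
have -> : a ^+ 3 - a = (a - 1) * (a * (a + 1)).
  by rewrite mulrCA -subr_sqr expr1n mulrBr mulr1 -exprS.
by rewrite !mulf_eq0 subr_eq0 addr_eq0 !inE.
Qed.

(** The index type I is free so that the same statement covers the family of
    all eigenspaces (I = K) and a family of three of them with integral labels
    (I = int), in both cases padded with zero subspaces. *)
Lemma tripotent_direct_sum (K : fieldType) (h2 : (2%:R : K) != 0)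
    (V : lmodType K) (f : {linear V -> V}) (f3 : forall x, f (f (f x)) = f x)
    (I : eqType) (lam : I -> K) (A : I -> V -> Prop) (p o m : I) :
  lam p = 1 -> lam o = 0 -> lam m = -1 ->
  (forall i v, i \in [:: p; o; m] -> A i v <-> f v = lam i *: v) ->
  (forall i v, i \notin [:: p; o; m] -> A i v -> v = 0) ->
  is_direct_sum A.
Proof.
move=> lp lo lm A_in A_out.
have uniq_lam : uniq [seq lam i | i <- [:: p; o; m]].
  by rewrite /= lp lo lm !inE -!addr_eq0 add0r oner_eq0 !andbT.
have [/andP[/norP[po /norP[pm _]] om] lam_inj] :
    (p \notin [:: o; m]) && (o != m) /\ {in [:: p; o; m] &, injective lam}.
  split; first by move: (map_uniq uniq_lam); rewrite /= !inE andbT.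
  move: uniq_lam; rewrite /= !inE negb_or andbT => /andP[/andP[]].
  move=> /eqP po /eqP pm /eqP om i j; rewrite !inE.
  by move=> /or3P[]/eqP-> /or3P[]/eqP-> // /esym.
split=> [x|s v uniq_s Av sum0].
  pose xp := 2%:R^-1 *: (f (f x) + f x); pose xm := 2%:R^-1 *: (f (f x) - f x).
  pose v i := if i == p then xp else if i == o then x - f (f x) else xm.
  have [vp vo vm] : [/\ v p = xp, v o = x - f (f x) & v m = xm].
    rewrite /v !eqxx (eq_sym o) (negPf po) (eq_sym m p) (negPf pm).
    by rewrite eq_sym (negPf om).
  exists [:: p; o; m], v; split; first exact: map_uniq uniq_lam.
    move=> i i_in; apply/A_in => //; move: i_in.
    rewrite !inE => /or3P[]/eqP->; rewrite ?vp ?vo ?vm ?lp ?lo ?lm.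
    - by rewrite scale1r linearZ linearD /= f3 addrC.
    - by rewrite scale0r linearB /= f3 subrr.
    by rewrite linearZ linearB /= f3 scaleN1r -scalerN opprB.
  rewrite !big_cons big_nil vp vo vm addr0 addrCA -scalerDr.
  by rewrite addrCA addrK -mulr2n -scaler_nat scalerA mulVf // scale1r subrK.
have v_out i : i \in s -> i \notin [:: p; o; m] -> v i = 0.
  by move=> si i_out; apply: A_out (Av i si).
move=> i si; case: (boolP (i \in [:: p; o; m])) => i_in; last exact: v_out.
apply: (eigenvectors_free (f := f) (lam := lam)
  (s := [seq j <- s | j \in [:: p; o; m]])).
- exact: filter_uniq.
- move=> j k; rewrite !mem_filter => /andP[j_in _] /andP[k_in _].
  exact: lam_inj.
- move=> j; rewrite mem_filter => /andP[j_in js].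
  by apply/A_in => //; apply: Av.
- rewrite big_filter -[RHS]sum0 [RHS](bigID (fun j => j \in [:: p; o; m])) /=.
  rewrite [X in _ = _ + X]big1_seq ?addr0 // => j /andP[j_out js].
  exact: v_out.
by rewrite mem_filter i_in.
Qed.

(** * The adjoint representation *)

HB.instance Definition _ (K : fieldType) (g : lieAlgType K) (x : g) :=
  GRing.isLinear.Build K g g *:%R (ad x)
    (fun a y z => lie_bracket_linearr a x y z).

Lemma adDl (K : fieldType) (g : lieAlgType K) (x y z : g) :
  ad (x + y) z = ad x z + ad y z.
Proof. by rewrite -[x]scale1r /ad lie_bracket_linearl !scale1r. Qed.

Lemma ad0l (K : fieldType) (g : lieAlgType K) (z : g) : ad 0 z = 0.
Proof. by apply: (addIr (ad 0 z)); rewrite -adDl !add0r. Qed.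

Lemma adZl (K : fieldType) (g : lieAlgType K) (a : K) (x z : g) :
  ad (a *: x) z = a *: ad x z.
Proof.
by rewrite -[a *: x]addr0 [LHS]lie_bracket_linearl -/(ad 0 z) ad0l addr0.
Qed.

Lemma adC (K : fieldType) (g : lieAlgType K) (x y : g) : ad x y = - ad y x.
Proof.
apply/eqP; rewrite -addr_eq0; apply/eqP.
have adxx z : ad z z = 0 :> g by apply: lie_bracket_alt.
by have := adxx (x + y); rewrite adDl !linearD /= !adxx add0r addr0.
Qed.

Lemma ad_derivation (K : fieldType) (g : lieAlgType K) (x y z : g) :
  ad x (ad y z) = ad (ad x y) z + ad y (ad x z).
Proof.
have : ad x (ad y z) + ad y (ad z x) + ad z (ad x y) = 0.
  exact: lie_bracket_jacobi.
rewrite (adC z (ad x y)) (adC z x) linearN /= => /eqP.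
by rewrite subr_eq0 subr_eq => /eqP.
Qed.

Lemma ad_eigenvector_bracket (K : fieldType) (g : lieAlgType K) (E : g)
    (a b : K) (x y : g) :
  ad E x = a *: x -> ad E y = b *: y -> ad E (ad x y) = (a + b) *: ad x y.
Proof.
by move=> Ex Ey; rewrite ad_derivation Ex Ey adZl linearZ /= -scalerDl.
Qed.

(** Where two degrees in {1, 0, -1} add up to 2 or -2 the bracket vanishes,
    since (+-2)^3 - (+-2) = +-6 is invertible. *)
Lemma tripotent_bracket_graded (K : fieldType) (h2 : (2%:R : K) != 0)
    (h3 : (3%:R : K) != 0) (g : lieAlgType K) (E : g)
    (E3 : forall x, ad E (ad E (ad E x)) = ad E x) : bracket_graded E.
Proof.
move=> i j x y; rewrite /component -/(ad x y).
have zero k : if k \in [:: 1; 0; -1] then in_eigenspace (ad E) k%:~R 0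
    else 0 = 0 :> g.
  by case: ifP => // _; rewrite /in_eigenspace linear0 scaler0.
case: ifP => [i_in Ex|_ ->]; last by rewrite ad0l => _; apply: zero.
case: ifP => [j_in Ey|_ ->]; last by rewrite linear0; apply: zero.
have := ad_eigenvector_bracket Ex Ey; rewrite -intrD => Exy.
case: ifP => // ij_out.
have unit6 : (6%:R : K) != 0 by rewrite (natrM _ 2 3) mulf_neq0.
have /eqP := tripotent_eigenvector E3 Exy; rewrite scaler_eq0.
case/orP => [|/eqP //]; rewrite -rmorphXn -rmorphB.
move: i_in j_in ij_out unit6; rewrite !inE.
by case/or3P=> /eqP-> /or3P[]/eqP-> // _ /negPf;
  rewrite ?rmorphN ?oppr_eq0 /= => ->.
Qed.

(** * Lifting along a central extension *)

Section CentralExtension.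

Context (K : fieldType) (g ghat : lieAlgType K) (q : {linear ghat -> g}).
Context (hq : central_extension q) (Ehat : ghat).
Let E := q Ehat.
Hypothesis E3 : forall x, ad E (ad E (ad E x)) = ad E x.
Hypothesis h2 : (2%:R : K) != 0.

Let D : {linear ghat -> ghat} := ad Ehat.

Lemma ad_liftE x : q (D x) = ad E (q x).
Proof. by case: hq => q_hom _ _; rewrite [LHS]q_hom. Qed.

Lemma ad_lift_ker z : q z = 0 -> D z = 0.
Proof.
by case: hq => _ _ central qz; rewrite /D /= adC [ad z _]central ?oppr0.
Qed.

Lemma ad_lift_pow4 x : D (D (D (D x))) = D (D x).
Proof.
apply/eqP; rewrite -subr_eq0 -linearB; apply/eqP.
by apply: ad_lift_ker; rewrite linearB !ad_liftE E3 subrr.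
Qed.

Lemma eigenvector_lift (a : K) (u : g) : a ^+ 2 = 1 -> ad E u = a *: u ->
  exists2 w : ghat, D w = a *: w & q w = u.
Proof.
move=> a2 Eu; case: (hq) => _ /(_ u)[w qw] _.
exists (2%:R^-1 *: (D (D w) + a *: D (D (D w)))).
  rewrite linearZ linearD linearZ /= ad_lift_pow4 [RHS]scalerA mulrC -scalerA.
  by rewrite [in RHS]addrC (scalerDr a) scalerA -expr2 a2 scale1r.
rewrite linearZ linearD linearZ /= !ad_liftE E3 qw !(Eu, linearZ) /= scalerA.
rewrite Eu scalerA -expr2 a2 scale1r.
by rewrite -mulr2n -scaler_nat scalerA mulVf ?scale1r.
Qed.

Hypothesis g0_span : forall x : g, ad E x = 0 -> exists (c : K) (y : g),
  bracket_span (component E 1) (component E (-1)) y /\ x = c *: E + y.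

(** The factors of each bracket lift to eigenvectors of D for 1 and -1; as D
    is a derivation, these eigenvalues add up to 0 on the lifted bracket. *)
Lemma bracket_span_lift (y : g) :
  bracket_span (component E 1) (component E (-1)) y ->
  exists2 w : ghat, D w = 0 & q w = y.
Proof.
case=> n [c [u [v [Eu Ev ->]]]].
case: (hq) => q_hom _ _.
elim/big_rec: _ => [|k _ _ [w Dw <-]]; first by exists 0; rewrite linear0.
have [uk Duk quk] : exists2 w, D w = 1 *: w & q w = u k.
  by apply: eigenvector_lift; [rewrite expr1n | apply: Eu].
have [vk Dvk qvk] : exists2 w, D w = -1 *: w & q w = v k.
  by apply: eigenvector_lift; [rewrite sqrrN expr1n | apply: Ev].
exists (c k *: ad uk vk + w); last first.
  by rewrite linearD linearZ /= [q (ad _ _)]q_hom quk qvk.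
rewrite linearD linearZ /= Dw (ad_eigenvector_bracket Duk Dvk).
by rewrite subrr scale0r scaler0 addr0.
Qed.

(** D has no nilpotent part, because Ehat, the lifts of [g_+, g_-] and the
    central elements span the generalized eigenspace for 0, and D kills them. *)
Lemma ad_lift_ker_sqr (x : ghat) : D (D x) = 0 -> D x = 0.
Proof.
move=> DDx.
have /g0_span[c [y [/bracket_span_lift[w Dw qw] qx]]] : ad E (q x) = 0.
  by rewrite -E3 -!ad_liftE DDx !linear0.
have DE : D Ehat = 0 by apply: lie_bracket_alt.
(* x and c Ehat + w agree up to a central element. *)
have /ad_lift_ker : q (x - (c *: Ehat + w)) = 0.
  by rewrite linearB linearD linearZ /= qw qx subrr.
by rewrite linearB linearD linearZ /= DE Dw scaler0 addr0 subr0.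
Qed.

Lemma ad_lift_tripotent (x : ghat) : D (D (D x)) = D x.
Proof.
apply/eqP; rewrite eq_sym -subr_eq0 -linearB; apply/eqP.
by apply: ad_lift_ker_sqr; rewrite !linearB /= ad_lift_pow4 subrr.
Qed.

End CentralExtension.

Theorem lemma7p2 (K : fieldType)
    (h2 : (2%:R : K) \is a GRing.unit) (h3 : (3%:R : K) \is a GRing.unit)
    (g : lieAlgType K) (E : g) (hE : three_graded E)
    (hg0 : forall x : g, component E 0 x <->
       exists (c : K) (y : g),
         bracket_span (component E 1) (component E (-1)) y /\ x = c *: E + y)
    (ghat : lieAlgType K) (q : {linear ghat -> g}) (hq : central_extension q)
    (Ehat : ghat) (hEhat : q Ehat = E) :
  [/\ is_diagonalizable (ad Ehat),
      forall a : K, is_eigenvalue (ad Ehat) a -> a \in [:: 1; 0; -1],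
      three_graded Ehat,
      bracket_graded Ehat
    & three_graded_morphism Ehat E q].
Proof.
rewrite !unitfE in h2 h3; subst E; case: hE => E3 _.
have D3 x : ad Ehat (ad Ehat (ad Ehat x)) = ad Ehat x.
  apply: (ad_lift_tripotent hq) => // y Ey; apply/hg0.
  by rewrite /component /in_eigenspace /= scale0r.
have eigen := tripotent_eigenvalue D3.
split=> //.
- apply: (tripotent_direct_sum h2 D3 (lam := id) (p := 1) (o := 0) (m := -1))
    => // a v a_out Dv.
  by apply/eqP; apply: contraNT a_out => vn0; apply: eigen; exists v.
- split=> //.
  apply: (tripotent_direct_sum h2 D3 (lam := intr) (p := 1) (o := 0) (m := -1))
    => // i v.
    by rewrite /component => ->.
  by rewrite /component => /negPf->.
- exact: tripotent_bracket_graded.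
split; first by case: hq.
move=> i x; rewrite /component; case: ifP => [_ Dx|_ ->]; last exact: linear0.
by rewrite /in_eigenspace -(ad_liftE hq) /= Dx linearZ.
Qed.
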